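(* Let $k\ge 0$ be an integer, let $N=4^k$, and let $\Omega=\Delta(A,B,C)$ be a non-degenerate triangle. Let $\mathcal{P}=(\boldsymbol{x}_1,\dots,\boldsymbol{x}_N)$ consist of the first $N$ triangular van der Corput points $\boldsymbol{x}_i=f_\Omega(i-1)$, $i=1,\dots,N$. Then the parallelogram discrepancy of $\mathcal{P}$ satisfies $$D_N^{\mathrm{P}}(\mathcal{P};\Omega)=\begin{cases}\dfrac79, & N=1,\\[1ex] \dfrac{2}{3\sqrt N}-\dfrac{1}{9N}, & N=4^k>1.\end{cases}$$
   Context: Triangles. For non-collinear points $A,B,C\in\mathbb{R}^d$, $\Delta(A,B,C)=\{\omega_1A+\omega_2B+\omega_3C : \omega_j\ge 0,\ \omega_1+\omega_2+\omega_3=1\}$ is a non-degenerate (closed) triangle. $\mathbf{vol}$ denotes two-dimensional Lebesgue measure in the plane containing the triangle. Parallelogram discrepancy. Let $\Omega=\Delta(A,B,C)$. For $a,b\in(0,1]$ let $\mathcal{T}_{a,b,C}=\{C+s(A-C)+t(B-C): 0\le s\le a,\ 0\le t\le b\}$ be the parallelogram with vertex $C$ and side vectors $a(A-C)$, $b(B-C)$. Let $\mathcal{S}_C=\{\mathcal{T}_{a,b,C}: 0<a\le 1,\ 0<b\le 1\}$, define $\mathcal{S}_A,\mathcal{S}_B$ analogously (vertex $A$, resp. $B$, with side vectors along the two triangle sides leaving that vertex), and $\mathcal{S}_{\mathrm{P}}=\mathcal{S}_A\cup\mathcal{S}_B\cup\mathcal{S}_C$. For a list $\mathcal{P}=(\boldsymbol{x}_1,\dots,\boldsymbol{x}_N)$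 of points of $\Omega$ and a measurable set $S$, put $\delta_N(S;\mathcal{P},\Omega)=\mathbf{vol}(S\cap\Omega)/\mathbf{vol}(\Omega)-\frac1N\sum_{i=1}^N 1_{\boldsymbol{x}_i\in S}$. Then $D_N^{\mathrm{P}}(\mathcal{P};\Omega)=\sup_{S\in\mathcal{S}_{\mathrm{P}}}|\delta_N(S;\mathcal{P},\Omega)|$. Triangular van der Corput points. For a triangle $T=\Delta(A,B,C)$ with ordered vertices and a digit $d\in\{0,1,2,3\}$ define the subtriangle $T(d)$ (with ordered vertices) by $T(0)=\Delta(\frac{B+C}2,\frac{A+C}2,\frac{A+B}2)$, $T(1)=\Delta(A,\frac{A+B}2,\frac{A+C}2)$, $T(2)=\Delta(\frac{B+A}2,B,\frac{B+C}2)$, $T(3)=\Delta(\frac{C+A}2,\frac{C+B}2,C)$. Recursively, $T(d_1,\dots,d_K)=(T(d_1,\dots,d_{K-1}))(d_K)$. For an integer $i\ge1$ write $i=\sum_{k=1}^{K}d_k4^{k-1}$ with $d_k\in\{0,1,2,3\}$; then $f_T(i)$ is the centroid (arithmetic mean of the vertices) of $T(d_1,\dots,d_K)$. This does not depend on how many leading zero digits are included, since $T'$ and $T'(0)$ have the same centroid. Also $f_T(0)$ is the centroid of $T$. *)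

(* Defs.v *)
From mathcomp Require Import all_boot all_order all_algebra.
From mathcomp Require Import all_classical all_reals all_analysis.
Set Implicit Arguments.
Unset Strict Implicit.
Unset Printing Implicit Defensive.
Import Order.TTheory GRing.Theory Num.Theory.
Local Open Scope classical_set_scope.
Local Open Scope ring_scope.

Definition collinear (R : realType) (d : nat) (A B C : 'rV[R]_d) : Prop :=
  exists (O v : 'rV[R]_d) (a b c : R),
    [/\ A = O + a *: v, B = O + b *: v & C = O + c *: v].

(* The order of the vertices matters for the labelling of the subtriangles. *)
Record triangle (R : realType) (d : nat) :=
  Triangle { vA : 'rV[R]_d; vB : 'rV[R]_d; vC : 'rV[R]_d }.

Definition nondegenerate_triangle (R : realType) (d : nat) (T : triangle R d) : Prop :=
  ~ collinear (vA T) (vB T) (vC T).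

Definition tri_set (R : realType) (d : nat) (T : triangle R d) :
    set 'rV[R]_d :=
  [set x | exists w1 w2 w3 : R,
    [/\ 0 <= w1, 0 <= w2, 0 <= w3, w1 + w2 + w3 = 1
      & x = w1 *: vA T + w2 *: vB T + w3 *: vC T]].

(* The library's norm on row vectors is the sup norm, hence these. *)
Definition dotv (R : realType) (d : nat) (u v : 'rV[R]_d) : R :=
  \sum_(i < d) u 0 i * v 0 i.

Definition normalize (R : realType) (d : nat) (u : 'rV[R]_d) : 'rV[R]_d :=
  (Num.sqrt (dotv u u))^-1 *: u.

(* Gram-Schmidt: when T is nondegenerate, [frame1 T, frame2 T] is an           *)
(* orthonormal basis (for the Euclidean inner product) of the direction of     *)
(* the plane containing T.                                                     *)
Definition frame1 (R : realType) (d : nat) (T : triangle R d) : 'rV[R]_d :=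
  normalize (vA T - vC T).

Definition frame2 (R : realType) (d : nat) (T : triangle R d) : 'rV[R]_d :=
  normalize ((vB T - vC T) - dotv (vB T - vC T) (frame1 T) *: frame1 T).

(* Two-dimensional Lebesgue measure in the plane of T: the measure of S read   *)
(* through the isometric chart (u, v) |-> C + u e1 + v e2 of that plane. It    *)
(* does not depend on which orthonormal frame of the plane is chosen.          *)
Definition vol (R : realType) (d : nat) (T : triangle R d)
    (S : set 'rV[R]_d) : \bar R :=
  (@lebesgue_measure R \x @lebesgue_measure R)%E
    [set p : R * R | S (vC T + p.1 *: frame1 T + p.2 *: frame2 T)].

Definition parallelogram (R : realType) (d : nat) (O P Q : 'rV[R]_d)
    (a b : R) : set 'rV[R]_d :=
  [set x | exists s t : R,
    [/\ 0 <= s <= a, 0 <= t <= b & x = O + s *: (P - O) + t *: (Q - O)]].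

Definition anchored (R : realType) (d : nat) (O P Q : 'rV[R]_d) :
    set (set 'rV[R]_d) :=
  [set S | exists a b : R,
    [/\ 0 < a <= 1, 0 < b <= 1 & S = parallelogram O P Q a b]].

Definition parallelograms (R : realType) (d : nat) (T : triangle R d) :
    set (set 'rV[R]_d) :=
  anchored (vA T) (vB T) (vC T) `|` anchored (vB T) (vA T) (vC T)
    `|` anchored (vC T) (vA T) (vB T).

Definition local_discrepancy (R : realType) (d : nat) (S : set 'rV[R]_d)
    (P : seq 'rV[R]_d) (T : triangle R d) : R :=
  fine (vol T (S `&` tri_set T)) / fine (vol T (tri_set T))
    - (size P)%:R^-1 * \sum_(x <- P) (\1_S x : R).

Definition parallelogram_discrepancy (R : realType) (d : nat)
    (P : seq 'rV[R]_d) (T : triangle R d) : \bar R :=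
  ereal_sup [set (`|local_discrepancy S P T|)%:E | S in parallelograms T].

Definition midpoint (R : realType) (d : nat) (X Y : 'rV[R]_d) : 'rV[R]_d :=
  2^-1 *: (X + Y).

Definition subtriangle (R : realType) (d : nat) (T : triangle R d)
    (j : 'I_4) : triangle R d :=
  let: Triangle A B C := T in
  match nat_of_ord j with
  | 0 => Triangle (midpoint B C) (midpoint A C) (midpoint A B)
  | 1 => Triangle A (midpoint A B) (midpoint A C)
  | 2 => Triangle (midpoint B A) B (midpoint B C)
  | _ => Triangle (midpoint C A) (midpoint C B) C
  end%N.

Definition centroid (R : realType) (d : nat) (T : triangle R d) : 'rV[R]_d :=
  3^-1 *: (vA T + vB T + vC T).

(* Base 4 digits of i, least significant first; up_log 4 i.+1 is the least K   *)
(* such that i < 4 ^ K, so there are none for i = 0.                           *)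
Definition digits4 (i : nat) : seq 'I_4 :=
  [seq inord ((i %/ 4 ^ j) %% 4) | j <- iota 0 (up_log 4 i.+1)].

Definition vdc (R : realType) (d : nat) (T : triangle R d) (i : nat) :
    'rV[R]_d :=
  centroid (foldl (@subtriangle R d) T (digits4 i)).

(* Main.v *)
(** Write n = 2^k. Cutting Omega into 4^k congruent triangles, the first 4^k
    points are the centroids of all the pieces, so in the affine coordinates
    attached to a vertex they form two shifted triangular lattices:
    ((i + 1/3)/n, (j + 1/3)/n) with i + j < n for the pieces placed like Omega, and
    ((i + 2/3)/n, (j + 2/3)/n) with i + j < n - 1 for the inverted ones. This set is
    invariant under permuting the vertices, so one vertex suffices. By
    inclusion-exclusion both the area and the number of points of the parallelogram
    a = x/n, b = y/n are combinations of areas and counts of homothetic corner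
    triangles, and n^2 times the local discrepancy becomes an explicit function of x
    and y that is quadratic on each cell of a grid of mesh 1/3. Bounding it cell by
    cell gives 2n/3 - 1/9, which is approached by a = 1, b -> 1/(3n) from below (an
    empty parallelogram); for n = 1 the worst case is a = b = 1/3. *)
Require Import Defs.
From mathcomp Require Import all_boot all_order all_algebra.
From mathcomp Require Import all_classical all_reals all_analysis.
From mathcomp Require Import measurable_realfun ring lra zify.
Import Order.TTheory GRing.Theory Num.Theory numFieldNormedType.Exports.
Local Open Scope classical_set_scope.
Local Open Scope ring_scope.

Set Implicit Arguments.
Unset Strict Implicit.
Unset Printing Implicit Defensive.

(** * Positive part *)

Definition pos (R : realDomainType) (t : R) := Num.max 0 t.

Lemma posE (R : realDomainType) (t : R) : pos t = if t <= 0 then 0 else t.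
Proof. by rewrite /pos; case: leP. Qed.

Lemma posN (R : realDomainType) (x : R) : x <= 0 -> pos x = 0.
Proof. by rewrite posE => ->. Qed.

Lemma pos_id (R : realDomainType) (x : R) : 0 <= x -> pos x = x.
Proof. by rewrite /pos => /max_r. Qed.

(** * Rounding to thirds *)

(* The conditions under which, for 0 < x <= n, the numbers of i in nat with
   i + 1/3 <= x and with i + 2/3 <= x are p and p' respectively. In what follows,
   the first alternative is type I, where x = P + e with |e| <= 1/3 and
   p = p' = P, and the second one is type II, where x = P + 1/2 + e with
   |e| <= 1/6, p = P + 1 and p' = P. *)
Definition third_counts (R : realFieldType) (n : nat) (x : R) (p p' : nat) : Prop :=
  [/\ p = p', (p' <= n)%N & p'%:R - 1/3 <= x < p'%:R + 1/3] \/
  [/\ p = p'.+1, (p' < n)%N & p'%:R + 1/3 <= x < p'%:R + 2/3].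

Lemma third_counts_exists (R : archiRealFieldType) (n : nat) (x : R) :
  0 < x <= n%:R -> exists p p' : nat,
    [/\ third_counts n x p p',
        forall i : nat, (x < i%:R + 1/3) = (p <= i)%N &
        forall i : nat, (x < i%:R + 2/3) = (p' <= i)%N].
Proof.
move=> /andP[x0 xn].
have /andP[l u] := Num.Theory.truncn_itv (ltW x0).
set m := Num.truncn x in l u.
have key (c : R) (i p : nat) : 0 <= c < 1 -> p%:R - 1 + c <= x -> x < p%:R + c ->
    (x < i%:R + c) = (p <= i)%N.
  move=> c01 h1 h2; apply/idP/idP => h.
    have : p%:R < i.+1%:R :> R by rewrite -natr1; lra.
    by rewrite ltr_nat.
  have : p%:R <= i%:R :> R by rewrite ler_nat.
  lra.
have mn : (m <= n)%N by rewrite -(ler_nat R); lra.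
rewrite -natr1 in u.
have mlt : m%:R < x -> (m < n)%N by move=> ?; rewrite -(ltr_nat R); lra.
case: (ltP x (m%:R + 1/3)) => h1.
  exists m, m; split; [left; split=> //; lra| |] => i; apply: key; lra.
case: (ltP x (m%:R + 2/3)) => h2.
  exists m.+1, m; split; [right; split=> //; [apply: mlt; lra|lra]| |] => i;
    apply: key; rewrite -?(natr1 m); lra.
(* Fractional part at least 2/3: type I around the next integer, with negative offset. *)
exists m.+1, m.+1; split; [left; split=> //; [apply: mlt; lra|rewrite -(natr1 m); lra]| |] => i;
  apply: key; rewrite -?(natr1 m); lra.
Qed.

Lemma natr_eq0_or_ge1 (R : realFieldType) (p : nat) : p%:R = 0 :> R \/ 1 <= p%:R :> R.
Proof. by case: p => [|p]; [left|right; rewrite (ler_nat R 1)]. Qed.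

(** * Polynomial estimates on a single cell of the grid *)

Section Bounds.
Variable R : realFieldType.
Implicit Types n P Q e f : R.

(** For x + y <= n the scaled area is 2xy and the two lattices contribute pq and p'q'. The
    difference is affine in e and in f separately, so products of slacks of the box serve as
    certificates; on the diagonal P + Q = n the extra constraint e + f <= 0 is needed. *)
Lemma below_I_I n P Q e f : 2 <= n -> 0 <= P -> 0 <= Q -> P = 0 \/ 1 <= P -> Q = 0 \/ 1 <= Q ->
  -(1/3) <= e -> e <= 1/3 -> -(1/3) <= f -> f <= 1/3 ->
  0 < P + e <= n -> 0 < Q + f <= n -> P + Q <= n - 1 \/ P + Q = n ->
  P + e + (Q + f) <= n ->
  `|2 * (P + e) * (Q + f) - P * Q - P * Q| <= 2 / 3 * n - 1 / 9.
Proof.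
move=> n2 P0 Q0 hP hQ e1 e2 f1 f2 /andP[x0 xn] /andP[y0 yn] hn hxy.
have A1 := mulr_ge0 P0 (ltac:(lra) : 0 <= 1/3 - f).
have A2 := mulr_ge0 P0 (ltac:(lra) : 0 <= f + 1/3).
have B1 := mulr_ge0 Q0 (ltac:(lra) : 0 <= 1/3 - e).
have B2 := mulr_ge0 Q0 (ltac:(lra) : 0 <= e + 1/3).
have C1 := mulr_ge0 (ltac:(lra) : 0 <= e + 1/3) (ltac:(lra) : 0 <= f + 1/3).
have C2 := mulr_ge0 (ltac:(lra) : 0 <= 1/3 - e) (ltac:(lra) : 0 <= f + 1/3).
have C3 := mulr_ge0 (ltac:(lra) : 0 <= e + 1/3) (ltac:(lra) : 0 <= 1/3 - f).
have C4 := mulr_ge0 (ltac:(lra) : 0 <= 1/3 - e) (ltac:(lra) : 0 <= 1/3 - f).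
case: hn => hn; first by rewrite ler_norml; apply/andP; split; lra.
case: hP => hP.
  have eQ : Q = n by lra.
  by subst Q P; rewrite ler_norml; apply/andP; split; nra.
case: hQ => hQ.
  have eP : P = n by lra.
  by subst Q P; rewrite ler_norml; apply/andP; split; nra.
have hQ' : Q = n - P by lra.
by subst Q; rewrite ler_norml; apply/andP; split; nra.
Qed.

Lemma below_I_II n P Q e f : 2 <= n -> 0 <= Q -> P = 0 \/ 1 <= P ->
  -(1/3) <= e -> e <= 1/3 -> -(1/6) <= f -> f <= 1/6 ->
  0 < P + e <= n -> P + Q <= n - 1 \/ P + Q = n ->
  P + e + (Q + 1/2 + f) <= n ->
  `|2 * (P + e) * (Q + 1/2 + f) - P * (Q + 1) - P * Q| <= 2 / 3 * n - 1 / 9.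
Proof.
move=> n2 Q0 hP e1 e2 f1 f2 /andP[x0 xn] hn hxy.
have P0 : 0 <= P by case: hP; lra.
have A1 := mulr_ge0 P0 (ltac:(lra) : 0 <= 1/6 - f).
have A2 := mulr_ge0 P0 (ltac:(lra) : 0 <= f + 1/6).
have B1 := mulr_ge0 Q0 (ltac:(lra) : 0 <= 1/3 - e).
have B2 := mulr_ge0 Q0 (ltac:(lra) : 0 <= e + 1/3).
have C1 := mulr_ge0 (ltac:(lra) : 0 <= e + 1/3) (ltac:(lra) : 0 <= f + 1/6).
have C2 := mulr_ge0 (ltac:(lra) : 0 <= 1/3 - e) (ltac:(lra) : 0 <= f + 1/6).
have C3 := mulr_ge0 (ltac:(lra) : 0 <= e + 1/3) (ltac:(lra) : 0 <= 1/6 - f).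
have C4 := mulr_ge0 (ltac:(lra) : 0 <= 1/3 - e) (ltac:(lra) : 0 <= 1/6 - f).
case: hn => hn; first by rewrite ler_norml; apply/andP; split; lra.
(* P + Q = n leaves e + f <= -1/2, hence a corner of the box; at P = 1 the value there is exactly
   -(2n/3 - 1/9). *)
have ee : e = - (1/3) by lra.
have ff : f = - (1/6) by lra.
case: hP => hP; first lra.
by subst e f; rewrite ler_norml; apply/andP; split; nra.
Qed.

Lemma below_II_II n P Q e f : 2 <= n -> 0 <= P -> 0 <= Q ->
  -(1/6) <= e -> e <= 1/6 -> -(1/6) <= f -> f <= 1/6 ->
  P + Q <= n - 1 ->
  `|2 * (P + 1/2 + e) * (Q + 1/2 + f) - (P + 1) * (Q + 1) - P * Q| <= 2 / 3 * n - 1 / 9.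
Proof.
move=> n2 P0 Q0 e1 e2 f1 f2 hn.
have A1 := mulr_ge0 P0 (ltac:(lra) : 0 <= 1/6 - f).
have A2 := mulr_ge0 P0 (ltac:(lra) : 0 <= f + 1/6).
have B1 := mulr_ge0 Q0 (ltac:(lra) : 0 <= 1/6 - e).
have B2 := mulr_ge0 Q0 (ltac:(lra) : 0 <= e + 1/6).
have C1 := mulr_ge0 (ltac:(lra) : 0 <= e + 1/6) (ltac:(lra) : 0 <= f + 1/6).
have C2 := mulr_ge0 (ltac:(lra) : 0 <= 1/6 - e) (ltac:(lra) : 0 <= f + 1/6).
have C3 := mulr_ge0 (ltac:(lra) : 0 <= e + 1/6) (ltac:(lra) : 0 <= 1/6 - f).
have C4 := mulr_ge0 (ltac:(lra) : 0 <= 1/6 - e) (ltac:(lra) : 0 <= 1/6 - f).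
by rewrite ler_norml; apply/andP; split; lra.
Qed.

(* The number of lattice points with first coordinate larger than x/n, minus n^2
   times the corresponding relative area. When x + y >= n the parallelogram is the
   complement of two disjoint such triangles. *)
Definition tail_err n p p' x :=
  ((n - p) * (n - p + 1) + (n - p') * (n - p' - 1)) / 2 - (n - x)^+2.

Lemma tail_err_I n P e : tail_err n P P (P + e) = 2 * (n - P) * e - e^+2.
Proof. by rewrite /tail_err; field. Qed.

Lemma tail_err_II n P e :
  tail_err n (P + 1) P (P + 1/2 + e) = 2 * (n - P - 1/2) * e - e^+2 - 1/4.
Proof. by rewrite /tail_err; field. Qed.

(* Here X = n - P and Y = n - Q for type I, n - P - 1/2 and n - Q - 1/2 for type II. *)
Lemma above_I_I n X Y e f : 2 <= n ->
  0 <= X -> 0 <= Y -> (X = 0 /\ e <= 0) \/ 1 <= X -> (Y = 0 /\ f <= 0) \/ 1 <= Y ->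
  -(1/3) <= e -> e <= 1/3 -> -(1/3) <= f -> f <= 1/3 ->
  X + Y <= n - 1 \/ X + Y = n ->
  X - e + (Y - f) <= n ->
  `|(2 * X * e - e^+2) + (2 * Y * f - f^+2)| <= 2 / 3 * n - 1 / 9.
Proof.
move=> n2 X0 Y0 hX hY e1 e2 f1 f2 hn hxy.
have A1 := mulr_ge0 X0 (ltac:(lra) : 0 <= 1/3 - e).
have A2 := mulr_ge0 X0 (ltac:(lra) : 0 <= e + 1/3).
have B1 := mulr_ge0 Y0 (ltac:(lra) : 0 <= 1/3 - f).
have B2 := mulr_ge0 Y0 (ltac:(lra) : 0 <= f + 1/3).
have C1 := mulr_ge0 (ltac:(lra) : 0 <= e + 1/3) (ltac:(lra) : 0 <= 1/3 - e).
have C2 := mulr_ge0 (ltac:(lra) : 0 <= 1/3 - f) (ltac:(lra) : 0 <= f + 1/3).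
have C3 := sqr_ge0 e.
have C4 := sqr_ge0 f.
case: hn => hn; first by rewrite ler_norml; apply/andP; split; lra.
(* A sharp case: equality at X = e = 0, Y = n, f = 1/3. This f is excluded from the half-open cell,
   so the value is only approached there. *)
have eY : Y = n - X by lra.
subst Y; rewrite ler_norml; apply/andP; split;
  case: hX => [[hX he]|hX]; case: hY => [[hY hf]|hY]; nra.
Qed.

Lemma above_I_II n X Y e f : 2 <= n ->
  0 <= X -> 1/2 <= Y ->
  -(1/3) <= e -> e <= 1/3 -> -(1/6) <= f -> f <= 1/6 ->
  X + Y <= n - 1/2 \/ X + Y = n + 1/2 ->
  X - e + (Y - f) <= n ->
  `|(2 * X * e - e^+2) + (2 * Y * f - f^+2 - 1/4)| <= 2 / 3 * n - 1 / 9.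
Proof.
move=> n2 X0 Y0 e1 e2 f1 f2 hn hxy.
have Y0' : 0 <= Y by lra.
have A1 := mulr_ge0 X0 (ltac:(lra) : 0 <= 1/3 - e).
have A2 := mulr_ge0 X0 (ltac:(lra) : 0 <= e + 1/3).
have B1 := mulr_ge0 Y0' (ltac:(lra) : 0 <= 1/6 - f).
have B2 := mulr_ge0 Y0' (ltac:(lra) : 0 <= f + 1/6).
have C1 := mulr_ge0 (ltac:(lra) : 0 <= e + 1/3) (ltac:(lra) : 0 <= 1/3 - e).
have C2 := mulr_ge0 (ltac:(lra) : 0 <= 1/6 - f) (ltac:(lra) : 0 <= f + 1/6).
have C3 := sqr_ge0 e.
have C4 := sqr_ge0 f.
case: hn => hn; first by rewrite ler_norml; apply/andP; split; lra.
(* X + Y = n + 1/2 leaves e + f >= 1/2, so both offsets are maximal. *)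
have ee : e = 1/3 by lra.
have ff : f = 1/6 by lra.
by subst e f; rewrite ler_norml; apply/andP; split; lra.
Qed.

Lemma above_II_II n X Y e f : 2 <= n ->
  1/2 <= X -> 1/2 <= Y ->
  -(1/6) <= e -> e <= 1/6 -> -(1/6) <= f -> f <= 1/6 ->
  X + Y <= n ->
  `|(2 * X * e - e^+2 - 1/4) + (2 * Y * f - f^+2 - 1/4)| <= 2 / 3 * n - 1 / 9.
Proof.
move=> n2 X0' Y0' e1 e2 f1 f2 hn.
have Y0 : 0 <= Y by lra.
have X0 : 0 <= X by lra.
have A1 := mulr_ge0 X0 (ltac:(lra) : 0 <= 1/6 - e).
have A2 := mulr_ge0 X0 (ltac:(lra) : 0 <= e + 1/6).
have B1 := mulr_ge0 Y0 (ltac:(lra) : 0 <= 1/6 - f).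
have B2 := mulr_ge0 Y0 (ltac:(lra) : 0 <= f + 1/6).
have C1 := mulr_ge0 (ltac:(lra) : 0 <= e + 1/6) (ltac:(lra) : 0 <= 1/6 - e).
have C2 := mulr_ge0 (ltac:(lra) : 0 <= 1/6 - f) (ltac:(lra) : 0 <= f + 1/6).
have C3 := sqr_ge0 e.
have C4 := sqr_ge0 f.
rewrite ler_norml; apply/andP; split; lra.
Qed.
End Bounds.

(** * Counting lattice cells *)

Lemma bin2S_natr (R : realFieldType) (m : nat) :
  'C(m.+1, 2)%:R = m%:R * (m%:R + 1) / 2 :> R.
Proof.
elim: m => [|m IH]; first by rewrite mul0r mul0r.
by rewrite binS bin1 natrD IH -natr1; field.
Qed.

Definition tri_sum (V : nmodType) (n : nat) (g : nat -> nat -> V) : V :=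
  \sum_(0 <= i < n) \sum_(0 <= j < n - i) g i j.

Lemma tri_sum_widen (V : nmodType) (m n : nat) (g : nat -> nat -> V) : (m <= n)%N ->
  tri_sum m g = \sum_(0 <= i < n) \sum_(0 <= j < m - i) g i j.
Proof.
move=> mn; rewrite [RHS](big_cat_nat (n := m)) //= [X in _ + X]big1_seq ?addr0 //.
by move=> i; rewrite mem_index_iota => /andP[_ /andP[mi _]]; rewrite big_geq //; lia.
Qed.

(* The complement of a triangle in a square is again a triangle, upside down. *)
Lemma tri_sum_rev (V : nmodType) (m n : nat) (g : nat -> nat -> V) : (n <= m.+1)%N -> (m <= n)%N ->
  \sum_(0 <= i < n) \sum_(m - i <= j < n) g i j =
  tri_sum (n + n - m.+1) (fun i j => g (n - i.+1)%N (n - j.+1)%N).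
Proof.
move=> h1 h2.
rewrite (@tri_sum_widen _ _ n); last by lia.
rewrite big_nat_rev /=; apply: eq_big_nat => i /andP[_ hi].
rewrite -{1}[(m - _)%N]add0n big_addn.
have -> : (n - (m - (0 + n - i.+1)) = n + n - m.+1 - i)%N by lia.
rewrite big_nat_rev /=; apply: eq_big_nat => j /andP[_ hj].
by congr (g _ _); lia.
Qed.

(** Midpoint subdivision on indices: three corner triangles and an inverted middle one. The
    hypotheses leave m = n (side 2n, middle of side n - 1) and m = n - 1 (side 2n - 1, middle of
    side n), one for each orientation of the cells. *)
Lemma tri_sum_double (V : nmodType) (m n : nat) (g : nat -> nat -> V) :
  (n <= m.+1)%N -> (m <= n)%N ->
  tri_sum (n + m) g =
   tri_sum m g + tri_sum m (fun i j => g (i + n)%N j) + tri_sum m (fun i j => g i (j + n)%N)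
   + tri_sum (n + n - m.+1) (fun i j => g (n - i.+1)%N (n - j.+1)%N).
Proof.
move=> h1 h2.
rewrite -tri_sum_rev // {1}/tri_sum (big_cat_nat (n := n)) //=; last by lia.
rewrite -[X in _ + \sum_(X <= i < _) _]add0n big_addn addKn.
rewrite (eq_big_nat _ _ (F2 := fun i => \sum_(0 <= j < m - i) g i j + \sum_(m - i <= j < n) g i j
   + \sum_(0 <= j < m - i) g i (j + n)%N)); last first.
  move=> i /andP[_ hi].
  rewrite (big_cat_nat (n := (m - i)%N)) //=; last by lia.
  rewrite (big_cat_nat (m := (m - i)%N) (n := n)) //=; try lia.
  rewrite -[X in _ + (_ + \sum_(X <= j < _) _)]add0n big_addn addrA.
  by have -> : (n + m - i - n = m - i)%N by lia.
rewrite !big_split /= -!tri_sum_widen //.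
have -> : \sum_(0 <= i < m) \sum_(0 <= j < n + m - (i + n)) g (i + n)%N j =
    tri_sum m (fun i j => g (i + n)%N j).
  by apply: eq_big_nat => i /andP[_ hi]; have -> : (n + m - (i + n) = m - i)%N by lia.
by rewrite (ACl (1*4*3*2)).
Qed.

Lemma sum_leq_nat (a m : nat) : (\sum_(0 <= j < m) (a <= j) = m - a)%N.
Proof.
elim: m => [|m IH]; first by rewrite big_geq.
by rewrite big_nat_recr //= IH; case: leqP => h; lia.
Qed.

Lemma sum_subn (q m : nat) : (\sum_(0 <= i < m) (i.+1 - q) = 'C((m - q).+1, 2))%N.
Proof.
elim: m => [|m IH]; first by rewrite big_geq.
rewrite big_nat_recr //= IH; case: (leqP q m) => h; first by rewrite subSn // [RHS]binS bin1.
by have [-> ->] : (m - q = 0 /\ m.+1 - q = 0)%N by lia.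
Qed.

(** Translating by (p, q) turns the part of the triangle in the quadrant into a triangle of side n -
    (p + q). *)
Lemma tri_sum_quadrant (p q n : nat) :
  tri_sum n (fun i j => nat_of_bool ((p <= i) && (q <= j))%N) = 'C((n - (p + q)).+1, 2).
Proof.
rewrite subnDA -sum_subn (@tri_sum_widen _ _ n) // big_nat_rev /=.
rewrite (eq_big_nat _ _ (F2 := fun i => if (i < n - p)%N then (i.+1 - q)%N else 0%N)); last first.
  move=> i /andP[_ hi].
  rewrite -[(i.+1 - q)%N]sum_leq_nat.
  have -> : (p <= 0 + n - i.+1)%N = (i < n - p)%N by lia.
  case: ifP => h; last by rewrite big1.
  by have -> : (n - (0 + n - i.+1) = i.+1)%N by lia.
rewrite -big_mkcond /= [in RHS](big_nat_widen _ _ n) //; lia.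
Qed.

(** * Lattice counts as polynomials, and the resulting bound *)

Section LatticeBound.
Variable R : realFieldType.

(** The range includes p = n + 1: truncated subtraction gives 0 there, and so does the factor n - p
    + 1. This one step of slack is needed for p + q. *)
Lemma bin2_subn_natr (n p : nat) : (p <= n.+1)%N ->
  'C((n - p).+1, 2)%:R = (n%:R - p%:R) * (n%:R - p%:R + 1) / 2 :> R.
Proof.
rewrite leq_eqVlt => /predU1P[->|pn]; first by rewrite subnS subnn bin_small // -natr1; field.
by rewrite bin2S_natr natrB.
Qed.

Lemma bin2_predn_subn_natr (n p : nat) : (p <= n)%N ->
  'C((n.-1 - p).+1, 2)%:R = (n%:R - p%:R) * (n%:R - p%:R - 1) / 2 :> R.
Proof.
case: n => [|n] pn; first by move: pn; rewrite leqn0 => /eqP ->; rewrite subr0 !mul0r.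
by rewrite bin2_subn_natr //= -(natr1 n); field.
Qed.

(* Inclusion-exclusion for the number of (i, j) with i + j < n, i < p and j < q. *)
Definition lattice_count (n p q : nat) : R :=
  'C(n.+1, 2)%:R - 'C((n - p).+1, 2)%:R - 'C((n - q).+1, 2)%:R + 'C((n - (p + q)).+1, 2)%:R.

Lemma bin2_add_square (n : nat) : 'C(n.+1, 2)%:R + 'C(n.-1.+1, 2)%:R = n%:R ^+ 2 :> R.
Proof.
have := bin2_subn_natr (leq0n n.+1); have := bin2_predn_subn_natr (leq0n n).
by rewrite !subn0 !subr0 => -> ->; field.
Qed.

Lemma third_counts_bounds (n : nat) (x : R) (p p' : nat) : third_counts n x p p' ->
  [/\ (p <= n)%N, (p' <= n)%N, p%:R - 2/3 <= x < p%:R + 1/3 & p'%:R - 1/3 <= x < p'%:R + 2/3].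
Proof.
by case=> [[-> h1 /andP[h2 h3]]|[-> h1 /andP[h2 h3]]]; split;
  rewrite ?(ltnW h1) -?(natr1 p') //; lra.
Qed.

(** Passage to the real parameters of the cell estimates; integrality survives only as gaps such as
    P = 0 or 1 <= P, which linear arithmetic can use. *)
Lemma third_counts_offset (n : nat) (x : R) (p p' : nat) : third_counts n x p p' ->
  exists P e : R, [/\ P = 0 \/ 1 <= P, P = n%:R \/ P <= n%:R - 1, p'%:R = P &
   ([/\ p%:R = P, x = P + e, -(1/3) <= e & e <= 1/3] \/
   [/\ p%:R = P + 1, x = P + 1/2 + e, -(1/6) <= e, e <= 1/6 & P <= n%:R - 1])].
Proof.
have h0 (m : nat) : m%:R = 0 :> R \/ 1 <= m%:R :> R := natr_eq0_or_ge1 R m.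
have h1 (m : nat) : (m < n)%N -> m%:R <= n%:R - 1 :> R.
  by move=> h; rewrite lerBrDr natr1 ler_nat.
case=> [[-> pn hx]|[-> pn hx]].
  exists p'%:R, (x - p'%:R); split=> //; last by left; split; lra.
  by move: pn; rewrite leq_eqVlt => /predU1P[->|/h1]; [left|right].
exists p'%:R, (x - p'%:R - 1/2); split=> //; first by right; exact: h1.
by right; rewrite -natr1; split; [by []| | | |exact: h1]; lra.
Qed.

Lemma natr_sum_trichotomy (p q n : nat) : p%:R + q%:R <= n%:R - 1 :> R \/
  p%:R + q%:R = n%:R :> R \/ n%:R + 1 <= p%:R + q%:R :> R.
Proof.
case: (ltngtP (p + q) n) => h.
- by left; rewrite lerBrDr -natrD natr1 ler_nat.
- by right; right; rewrite natr1 -natrD ler_nat.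
- by right; left; rewrite -natrD h.
Qed.

(** With a = x/n and b = y/n, the quantity inside the norm is n^2 times the local discrepancy. Each
    side of the line x + y = n splits into four cases by the types of x and y. *)
Lemma lattice_bound (n : nat) (x y : R) (p p' q q' : nat) :
  (1 < n)%N -> 0 < x <= n%:R -> 0 < y <= n%:R ->
  third_counts n x p p' -> third_counts n y q q' ->
  `|n%:R ^+ 2 - (n%:R - x) ^+ 2 - (n%:R - y) ^+ 2 + pos (n%:R - x - y) ^+ 2
    - (lattice_count n p q + lattice_count n.-1 p' q')| <= 2 / 3 * n%:R - 1 / 9.
Proof.
move=> n1 hx hy gx gy.
have n2 : 2 <= n%:R :> R by rewrite (ler_nat R 2).
have [pn p'n /andP[x1 x2] /andP[x3 x4]] := third_counts_bounds gx.
have [qn q'n /andP[y1 y2] /andP[y3 y4]] := third_counts_bounds gy.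
have [P [e [P0 Pn eP' hP]]] := third_counts_offset gx.
have [Q [f [Q0 Qn eQ' hQ]]] := third_counts_offset gy.
have hPQ := natr_sum_trichotomy p' q' n.
have E : lattice_count n p q + lattice_count n.-1 p' q' = n%:R ^+ 2
    - ((n%:R - p%:R) * (n%:R - p%:R + 1) + (n%:R - p'%:R) * (n%:R - p'%:R - 1)) / 2
    - ((n%:R - q%:R) * (n%:R - q%:R + 1) + (n%:R - q'%:R) * (n%:R - q'%:R - 1)) / 2
    + ('C((n - (p + q)).+1, 2)%:R + 'C((n.-1 - (p' + q')).+1, 2)%:R).
  rewrite /lattice_count -bin2_add_square (bin2_subn_natr (leqW pn)) (bin2_subn_natr (leqW qn)).
  by rewrite (bin2_predn_subn_natr p'n) (bin2_predn_subn_natr q'n); field.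
case: (leP (x + y) n%:R) => hxy.
  (* In this range the truncated binomials agree with their polynomials, and the expression
     collapses to 2xy - pq - p'q'. *)
  have h1 : (p + q <= n.+1)%N by rewrite -ltnS -(ltr_nat R) natrD -!natr1; lra.
  have h2 : (p' + q' <= n)%N by rewrite -ltnS -(ltr_nat R) natrD -!natr1; lra.
  rewrite E (bin2_subn_natr h1) (bin2_predn_subn_natr h2) /pos max_r; last lra.
  rewrite (_ : _ - _ = 2 * x * y - p%:R * q%:R - p'%:R * q'%:R); last by rewrite !natrD; field.
  clear x1 x2 x3 x4 y1 y2 y3 y4 E; move: hPQ hx hy hxy; rewrite eP' eQ'.
  case: hP => [[-> -> e1 e2]|[-> -> e1 e2 e3]];
    case: hQ => [[-> -> f1 f2]|[-> -> f1 f2 f3]] => hPQ hx hy hxy.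
  - apply: below_I_I => //; lra.
  - by apply: below_I_II => //; lra.
  - rewrite (_ : _ - _ = 2 * (Q + f) * (P + 1/2 + e) - Q * (P + 1) - Q * P); last by ring.
    by apply: below_I_II => //; lra.
  - apply: below_II_II => //; lra.
(* Beyond the diagonal the intersection terms vanish, and the error splits into one tail for x and
   one for y. *)
have h1 : (n <= p + q)%N by rewrite -ltnS -(ltr_nat R) -natr1 natrD; lra.
have h2 : (n.-1 <= p' + q')%N.
  rewrite -ltnS (ltn_predK n1) -ltnS -(ltr_nat R) -!natr1 natrD; lra.
have h3 : n%:R <= p'%:R + q'%:R + 1 :> R.
  by rewrite -natrD natr1 ler_nat; move: h2; case: (n) n1.
rewrite eP' eQ' in h3.
rewrite E; move/eqP: h1 => ->; move/eqP: h2 => ->.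
rewrite /pos max_l ?expr0n /=; last lra.
rewrite (_ : _ - _ = tail_err n%:R p%:R p'%:R x + tail_err n%:R q%:R q'%:R y); last first.
  by rewrite /tail_err bin_small //; field.
clear x1 x2 x3 x4 y1 y2 y3 y4 E; move: hPQ hx hy hxy; rewrite eP' eQ'.
case: hP => [[-> -> e1 e2]|[-> -> e1 e2 e3]];
  case: hQ => [[-> -> f1 f2]|[-> -> f1 f2 f3]] => hPQ hx hy hxy;
  rewrite ?tail_err_I ?tail_err_II.
- apply: above_I_I => //; lra.
- apply: above_I_II => //; lra.
- rewrite addrC; apply: above_I_II => //; lra.
- apply: above_II_II => //; lra.
Qed.
End LatticeBound.

(** * The van der Corput points form a lattice *)

Section VdC.
Variables (R : realType) (d : nat).
Implicit Type T : triangle R d.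

Lemma centroid_subtriangle0 T (j : 'I_4) :
  j = 0%N :> nat -> centroid (subtriangle T j) = centroid T.
Proof.
case: T => A B C; rewrite /subtriangle => -> ; rewrite /centroid /midpoint /=.
by apply/rowP => t; rewrite !mxE; field.
Qed.

(* Padding with zero digits is harmless: the middle subtriangle has the centroid of
   the whole. *)
Lemma vdc_digits T (K i : nat) : (i < 4 ^ K)%N ->
  vdc T i =
  centroid (foldl (@subtriangle R d) T [seq inord ((i %/ 4 ^ j) %% 4) | j <- iota 0 K]).
Proof.
move=> iK.
have : (up_log 4 i.+1 <= K)%N by apply: up_log_min.
rewrite /vdc /digits4; have := @up_logP 4 i.+1 isT; set L := up_log _ _ => hL /subnKC <-.
elim: (K - L)%N => [|t IH]; first by rewrite addn0.
rewrite IH addnS -(addn1 (L + t)) [iota 0 (_ + 1)]iotaD map_cat foldl_cat /= centroid_subtriangle0 //.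
rewrite inordK divn_small ?mod0n //; apply: leq_trans hL _; rewrite leq_exp2l //; lia.
Qed.

(** The least significant digit selects the first subdivision. *)
Lemma vdc_rec T (i : nat) (j : 'I_4) : vdc T (4 * i + j) = vdc (subtriangle T j) i.
Proof.
have h : (i < 4 ^ i)%N by apply: ltn_expl.
have h' : (4 * i + j < 4 ^ i.+1)%N by have := ltn_ord j; rewrite expnS; lia.
rewrite (vdc_digits _ h) (vdc_digits _ h') /= expn0 divn1.
have -> : inord ((4 * i + j) %% 4) = j :> 'I_4.
  by apply: val_inj; rewrite /= inordK ?ltn_mod // mulnC modnMDl modn_small.
rewrite (iotaDl 1 0) -map_comp; congr (centroid (foldl _ _ _)).
apply: eq_map => t /=; rewrite add1n expnS divnMA; congr (inord (_ %% 4)).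
by rewrite mulnC divnMDl // (divn_small (ltn_ord j)) addn0.
Qed.

Lemma sum_vdc_rec (V : nmodType) (g : 'rV[R]_d -> V) T (k : nat) :
  \sum_(0 <= i < 4 ^ k.+1) g (vdc T i) =
  \sum_(j < 4) \sum_(0 <= i < 4 ^ k) g (vdc (subtriangle T j) i).
Proof.
rewrite expnS exchange_big /=; elim: (4 ^ k)%N => [|m IH]; first by rewrite muln0 !big_geq.
rewrite [RHS]big_nat_recr // -IH /= mulnS addnC addnS addn3 !big_nat_recr //= -!addrA.
congr (_ + _); rewrite !big_ord_recr big_ord0 /= add0r -!addrA.
by rewrite -!vdc_rec /= addn0 addn1 addn2 addn3.
Qed.

(** * Invariance of the point set under relabelling the vertices *)

Definition swapBC T := Triangle (vA T) (vC T) (vB T).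
Definition rot T := Triangle (vB T) (vC T) (vA T).

Lemma midpointC (X Y : 'rV[R]_d) : midpoint X Y = midpoint Y X.
Proof. by rewrite /midpoint addrC. Qed.

(** Relabelling permutes the four subtriangles and relabels each of them in the same way, so
    induction on k applies. *)
Lemma sum_vdc_swapBC (V : nmodType) (g : 'rV[R]_d -> V) T (k : nat) :
  \sum_(0 <= i < 4 ^ k) g (vdc (swapBC T) i) = \sum_(0 <= i < 4 ^ k) g (vdc T i).
Proof.
elim: k T => [|k IH] [A B C].
  by rewrite !big_nat1 /vdc /digits4 up_log1 /centroid /= addrAC.
rewrite !sum_vdc_rec !big_ord_recr !big_ord0 /= !add0r.
rewrite (midpointC C B) (midpointC B A) (midpointC C A).
by rewrite addrAC; congr (_ + _ + _ + _); rewrite -[RHS]IH.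
Qed.

Lemma sum_vdc_rot (V : nmodType) (g : 'rV[R]_d -> V) T (k : nat) :
  \sum_(0 <= i < 4 ^ k) g (vdc (rot T) i) = \sum_(0 <= i < 4 ^ k) g (vdc T i).
Proof.
elim: k T => [|k IH] [A B C].
  by rewrite !big_nat1 /vdc /digits4 up_log1 /centroid /= [A + B + C](ACl (2*3*1)).
rewrite !sum_vdc_rec !big_ord_recr !big_ord0 /= !add0r.
rewrite (midpointC C B) (midpointC B A) (midpointC C A).
by rewrite [RHS](ACl (1*3*4*2)); congr (_ + _ + _ + _); rewrite -[RHS]IH.
Qed.

Definition bary T (x y : R) := vC T + x *: (vA T - vC T) + y *: (vB T - vC T).

Lemma bary_subtriangle3 (A B C : 'rV[R]_d) (x y : R) :
  bary (Triangle (midpoint C A) (midpoint C B) C) x y = bary (Triangle A B C) (x / 2) (y / 2).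
Proof. by rewrite /bary /midpoint /=; apply/rowP => t; rewrite !mxE; field. Qed.

Lemma bary_subtriangle1 (A B C : 'rV[R]_d) (x y : R) :
  bary (Triangle A (midpoint A B) (midpoint A C)) x y = bary (Triangle A B C) ((1 + x) / 2) (y / 2).
Proof. by rewrite /bary /midpoint /=; apply/rowP => t; rewrite !mxE; field. Qed.

Lemma bary_subtriangle2 (A B C : 'rV[R]_d) (x y : R) :
  bary (Triangle (midpoint B A) B (midpoint B C)) x y = bary (Triangle A B C) (x / 2) ((1 + y) / 2).
Proof. by rewrite /bary /midpoint /=; apply/rowP => t; rewrite !mxE; field. Qed.

Lemma bary_subtriangle0 (A B C : 'rV[R]_d) (x y : R) :
  bary (Triangle (midpoint B C) (midpoint A C) (midpoint A B)) x y =
  bary (Triangle A B C) ((1 - x) / 2) ((1 - y) / 2).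
Proof. by rewrite /bary /midpoint /=; apply/rowP => t; rewrite !mxE; field. Qed.

(** Induction on k: corner subtriangles keep their orientation, while the middle one is reversed,
    which exchanges the offsets 1/3 and 2/3 because n - (i + 1/3) = (n - i - 1) + 2/3. *)
Lemma sum_vdc (V : nmodType) (g : 'rV[R]_d -> V) T (k : nat) :
  let n := (2 ^ k)%N in
  let cell c i j := bary T ((i%:R + c) / n%:R) ((j%:R + c) / n%:R) in
  \sum_(0 <= i < 4 ^ k) g (vdc T i) =
  tri_sum n (fun i j => g (cell (1/3) i j)) + tri_sum n.-1 (fun i j => g (cell (2/3) i j)).
Proof.
elim: k T => [|k IH] T n cell.
  rewrite /tri_sum /= [X in _ = _ + X]big_geq // addr0 !big_nat1 /vdc /digits4 up_log1 /cell /=.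
  congr g; rewrite /bary /centroid /n expn0 !divr1 !add0r; apply/rowP => t; rewrite !mxE.
  by field.
rewrite (sum_vdc_rec g T k) !big_ord_recr big_ord0 /= add0r !IH.
have n0 : (0 < 2 ^ k)%N by rewrite expn_gt0.
have n0R : (2 ^ k)%:R != 0 :> R by rewrite pnatr_eq0; lia.
have -> : n = (2 ^ k + 2 ^ k)%N by rewrite /n expnS; lia.
have e1 : (2 ^ k + 2 ^ k).-1 = (2 ^ k + (2 ^ k).-1)%N by lia.
rewrite e1 !tri_sum_double //; try lia.
have -> : (2 ^ k + 2 ^ k - (2 ^ k).+1 = (2 ^ k).-1)%N by lia.
have -> : (2 ^ k + 2 ^ k - (2 ^ k).-1.+1 = 2 ^ k)%N by lia.
have -> : cell = fun c i j => bary T ((i%:R + c) / ((2 ^ k)%:R + (2 ^ k)%:R))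
                                     ((j%:R + c) / ((2 ^ k)%:R + (2 ^ k)%:R)).
  by rewrite /cell /n expnS mul2n -addnn natrD.
move: n0 n0R; clear n cell e1 IH; move: (2 ^ k)%N => n n0 n0R.
case: T => A B C; rewrite /subtriangle /=.
set S := @tri_sum V.
have eS (m : nat) (f1 f2 : nat -> nat -> V) :
    (forall i j, (i < m)%N -> (j < m - i)%N -> f1 i j = f2 i j) -> S m f1 = S m f2.
  move=> h; apply: eq_big_nat => i /andP[_ hi].
  by apply: eq_big_nat => j /andP[_ hj]; apply: h.
(* Both sides now have eight pieces, two lattices times four subtriangles; the permutation pairs
   them up. *)
rewrite !addrA [RHS](ACl (8*4*2*6*3*7*1*5)) /=.
have n2R : n%:R + n%:R != 0 :> R by rewrite -mulr2n mulrn_eq0.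
have cg x y x' y' : x = x' -> y = y' ->
    g (bary (Triangle A B C) x y) = g (bary (Triangle A B C) x' y').
  by move=> -> ->.
repeat match goal with |- _ + _ = _ + _ => apply: (f_equal2 (@GRing.add V)) end.
all: apply: eS => i j hi hj.
all: rewrite ?bary_subtriangle0 ?bary_subtriangle1 ?bary_subtriangle2 ?bary_subtriangle3.
all: have hi' : (i.+1 <= n)%N by lia.
all: have hj' : (j.+1 <= n)%N by lia.
all: apply: cg; rewrite ?(natrB _ hi') ?(natrB _ hj') ?natrD -?(natr1 i) -?(natr1 j).
all: by field; rewrite n2R.
Qed.
End VdC.

(** * Areas *)

Section SliceArea.
Variable R : realType.

(** Squaring removes the kink at 0: for all signs the error of the linear approximation is at most
    h^2. *)
Lemma is_derive_sqr_pos (x : R) : is_derive x 1 (fun t : R => pos t ^+ 2) (2 * pos x).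
Proof.
have lim : h^-1 *: (((fun t : R => pos t ^+ 2) \o shift x) (h *: 1) - pos x ^+ 2)
    @[h --> 0^'] --> 2 * pos x.
  apply/cvgrPdist_le => e e0; near=> h.
  have h0 : h != 0 by near: h; exact: nbhs_dnbhs_neq.
  have he : `|h| <= e by apply: ltW; near: h; exact: dnbhs0_lt.
  apply: le_trans he; rewrite /= /GRing.scale /= mulr1.
  rewrite -(ler_pM2l (_ : 0 < `|h|)) ?normr_gt0 // -normrM.
  rewrite -expr2 real_normK ?num_real //.
  rewrite (_ : h * _ = 2 * h * pos x - (pos (h + x) ^+ 2 - pos x ^+ 2)); last by field.
  rewrite ler_norml !posE.
  by case: (leP x 0) => hx; case: (leP (h + x) 0) => hy; apply/andP; split; nra.
split; first by apply/cvg_ex; eexists; exact: lim.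
exact: cvg_lim lim.
Unshelve. all: by end_near.
Qed.

Lemma is_derive_sqr_pos_affine (h k x : R) :
  is_derive x 1 (fun v => pos (k - v / h) ^+ 2) (2 * pos (k - x / h) * - h^-1).
Proof.
have d : is_derive x 1 (fun v => k - v / h) (- h^-1).
  have -> : (fun v => k - v / h) = cst k - (h^-1 *: id) :> (R -> R).
    by apply/funext => v /=; rewrite /GRing.scale /= mulrC.
  have -> : - h^-1 = 0 - h^-1 *: 1 :> R by rewrite /GRing.scale /= mulr1 sub0r.
  exact: is_deriveB.
exact: (is_derive1_comp (is_derive_sqr_pos _) d).
Qed.

(* For t >= 0 the length of {al in [0, t] | al <= a, t - al <= c}: in barycentric
   coordinates, the cut at be = 1 - t of the region al <= a, ga <= c. *)
Definition slice (a c t : R) := pos t - pos (t - a) - pos (t - c) + pos (t - a - c).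

(** An antiderivative of 2 * [slice a c]. *)
Definition slice_prim (a c t : R) :=
  pos t ^+ 2 - pos (t - a) ^+ 2 - pos (t - c) ^+ 2 + pos (t - a - c) ^+ 2.

Lemma is_derive_slice (a c h r x : R) : h != 0 ->
  is_derive x 1 (fun v => - (r * h / 2) * slice_prim a c (1 - v / h)) (r * slice a c (1 - x / h)).
Proof.
move=> h0.
have e (k : R) : is_derive x 1 (fun v => pos (1 - v / h - k) ^+ 2)
    (2 * pos (1 - x / h - k) * - h^-1).
  have -> : (fun v => pos (1 - v / h - k) ^+ 2) = (fun v => pos ((1 - k) - v / h) ^+ 2).
    by apply/funext => v; rewrite addrAC.
  rewrite [1 - _ - k]addrAC; exact: is_derive_sqr_pos_affine.
have H := is_deriveZ (- (r * h / 2)) (is_deriveD (is_deriveB (is_deriveB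
  (is_derive_sqr_pos_affine h 1 x) (e a)) (e c)) (e (a + c))).
rewrite (_ : (fun v => _) = - (r * h / 2) \*: ((fun v => pos (1 - v / h) ^+ 2)
    - (fun v => pos (1 - v / h - a) ^+ 2) - (fun v => pos (1 - v / h - c) ^+ 2)
    + (fun v => pos (1 - v / h - (a + c)) ^+ 2))); last first.
  by apply/funext => v; rewrite /slice_prim -[_ - a - c]addrA -opprD.
by apply: is_derive_eq; rewrite /slice /GRing.scale /= opprD !addrA; field.
Qed.

Lemma continuous_pos : continuous (@pos R).
Proof. by move=> x; apply: continuous_max; [exact: cvg_cst|exact: cvg_id]. Qed.

Lemma continuous_slice (a c h r : R) : continuous (fun x : R => r * slice a c (1 - x / h)).
Proof.
have e (k : R) : continuous (fun v : R => pos (1 - v / h - k)).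
  move=> x; apply: (continuous_comp (f := fun v : R => 1 - v / h - k)); last exact: continuous_pos.
  by apply: cvgB; [apply: cvgB; [exact: cvg_cst|apply: cvgMl; exact: cvg_id]|exact: cvg_cst].
move=> x; apply: cvgMr; rewrite /slice.
have e0 : continuous (fun v : R => pos (1 - v / h)).
  by have := e 0; under eq_fun do rewrite subr0.
have eac : continuous (fun v : R => pos (1 - v / h - a - c)).
  by have := e (a + c); under eq_fun do rewrite opprD addrA.
by apply: cvgD; [apply: cvgB; [apply: cvgB; [exact: e0|exact: e]|exact: e]|exact: eac].
Qed.

Lemma integral_slice (a c h r b : R) : 0 < h -> 0 < b ->
  (\int[lebesgue_measure]_(x in `[0%R, (h * b)%R]) (r * slice a c (1 - x / h))%:E =
  (r * h / 2 * (slice_prim a c 1 - slice_prim a c (1 - b)))%:E)%E.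
Proof.
move=> h0 b0.
pose F v := - (r * h / 2) * slice_prim a c (1 - v / h).
have dF (x : R) : is_derive x 1 F (r * slice a c (1 - x / h)).
  by apply: is_derive_slice; exact: lt0r_neq0.
have cF : continuous F.
  by move=> x; apply/differentiable_continuous/derivable1_diffP; have [] := dF x.
rewrite (@continuous_FTC2 _ _ F) ?mulr_gt0 //.
- rewrite -EFinB /F mul0r subr0 (_ : h * b / h = b); [congr EFin; ring|field; exact: lt0r_neq0].
- by apply: continuous_subspaceT; exact: continuous_slice.
- split; first by move=> x _; have [] := dF x.
    exact/cvg_at_right_filter/cF.
  exact/cvg_at_left_filter/cF.
- by move=> x _; rewrite derive1E; have [] := dF x.
Qed.

Lemma lebesgue_measure_cc (x y : R) : lebesgue_measure (`[x, y] : set R) = (pos (y - x))%:E.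
Proof.
rewrite lebesgue_measure_itv /= lte_fin posE subr_le0.
by case: ltP => // _; rewrite -EFinB.
Qed.

(* In an orthonormal chart a triangle has a base r, a height h and a shear s; the
   three conditions bound its barycentric coordinates. *)
Definition region (r h s a b c : R) : set (R * R) :=
  [set p | [/\ 0 <= (p.1 - s * (p.2 / h)) / r <= a, 0 <= p.2 / h <= b &
    0 <= 1 - (p.1 - s * (p.2 / h)) / r - p.2 / h <= c]].

Lemma measurable_region (r h s a b c : R) : measurable (region r h s a b c).
Proof.
have H (f : R * R -> R) (x y : R) : measurable_fun setT f -> measurable [set p | x <= f p <= y].
  move=> mf.
  have -> : [set p | x <= f p <= y] = setT `&` f @^-1` `[x, y].
    by rewrite setTI; apply/seteqP; split => p /=; rewrite in_itv.
  exact: mf.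
have m2 : measurable_fun setT (fun p : R * R => p.2 / h).
  by apply: measurable_funM => //; exact: measurable_snd.
have m1 : measurable_fun setT (fun p : R * R => (p.1 - s * (p.2 / h)) / r).
  apply: measurable_funM => //; apply: measurable_funB; first exact: measurable_fst.
  exact: measurable_funM.
have -> : region r h s a b c = [set p | 0 <= (p.1 - s * (p.2 / h)) / r <= a] `&`
   [set p | 0 <= p.2 / h <= b] `&` [set p | 0 <= 1 - (p.1 - s * (p.2 / h)) / r - p.2 / h <= c].
  by apply/seteqP; split => p /= => [[]|[[]]].
apply: measurableI; first by apply: measurableI; exact: H.
by apply: H; apply: measurable_funB => //; apply: measurable_funB.
Qed.

Lemma ysection_region (r h s a b c y : R) :
  0 < r -> 0 < h -> 0 <= a -> b <= 1 -> 0 <= c -> y \in `[0, h * b] ->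
  lebesgue_measure (ysection (region r h s a b c) y) = (r * slice a c (1 - y / h))%:E.
Proof.
move=> r0 h0 a0 b1 c0; rewrite in_itv /= => /andP[y0 yb].
set t := y / h.
have t0 : 0 <= t by rewrite divr_ge0 // ltW.
have tb : t <= b by rewrite ler_pdivrMr // mulrC.
(* The endpoints may come in the wrong order; the interval is then empty and [lebesgue_measure_cc]
   returns 0 through [pos]. *)
have -> : ysection (region r h s a b c) y =
    `[s * t + r * pos (1 - t - c), s * t + r * (Num.min a (1 - t))]%classic.
  rewrite /ysection; apply/seteqP; split => x /=; rewrite in_itv /= in_setE /region /= -/t.
    set al := _ / r; have -> : x = s * t + r * al by rewrite /al; field; exact: lt0r_neq0.
    rewrite !lerD2l !ler_pM2l // => -[/andP[h1 h2] _ /andP[h3 h4]].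
    by rewrite le_min posE; case: ifP; lra.
  set al := _ / r; have -> : x = s * t + r * al by rewrite /al; field; exact: lt0r_neq0.
  rewrite !lerD2l !ler_pM2l // le_min posE => hx.
  by split; move: hx; case: ifP; lra.
rewrite lebesgue_measure_cc; congr EFin.
rewrite (_ : _ + _ - _ = r * (Num.min a (1 - t) - pos (1 - t - c))); last by ring.
have pM u : pos (r * u) = r * pos u by rewrite /pos -{1}(mulr0 r) maxr_pMr // ltW.
rewrite pM /slice (@pos_id _ (1 - t)) ?subr_ge0 ?(le_trans tb) // !posE minEle; congr (_ * _).
case: (leP a (1 - t)) => ?; case: (leP (1 - t - c) 0) => ?;
  case: (leP (1 - t - a) 0) => ?; case: (leP (1 - t - a - c) 0) => ?; case: leP => ? /=; lra.
Qed.

Lemma measure_region (r h s a b c : R) : 0 < r -> 0 < h -> 0 <= a -> 0 < b <= 1 -> 0 <= c ->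
  (lebesgue_measure \x lebesgue_measure)%E (region r h s a b c) =
  (r * h / 2 * (slice_prim a c 1 - slice_prim a c (1 - b)))%:E.
Proof.
move=> r0 h0 a0 /andP[b0 b1] c0.
(* The product is exchanged for the one that integrates horizontal cuts over the second
   coordinate. *)
rewrite (@product_measure_unique _ _ _ _ _ _ _ (lebesgue_measure \x^ lebesgue_measure)%E); last 2 first.
- by move=> B C mB mC /=; rewrite product_measure2E.
- exact: measurable_region.
rewrite /= /product_measure2 -integral_slice // [RHS]integral_mkcond.
apply: eq_integral => y _ /=; rewrite patchE.
case: ifPn => yb.
  by rewrite ysection_region //; move: yb; rewrite in_setE.
rewrite (_ : ysection _ _ = set0) ?measure0 //.
apply/seteqP; split => // x; rewrite /ysection /= in_setE /region /= => -[_ /andP[h1 h2] _].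
move/negP: yb; apply; rewrite in_setE /= in_itv /=.
by rewrite mulrC -ler_pdivrMr // h2 -(mul0r h) -ler_pdivlMr // h1.
Qed.

End SliceArea.

(** * Barycentric coordinates, and areas read through the orthonormal chart *)

Section Coordinates.
Variables (R : realType) (d : nat).
Implicit Types (T : triangle R d) (u v w : 'rV[R]_d).

Lemma nondegenerate_free T : nondegenerate_triangle T -> forall x y : R,
  x *: (vA T - vC T) + y *: (vB T - vC T) = 0 -> x = 0 /\ y = 0.
Proof.
move=> nd x y e; have [x0|x0] := eqVneq x 0; last first.
  exfalso; apply: nd; exists (vC T), (vB T - vC T), (- (y / x)), 1, 0; split.
  - have -> : vA T = vC T + x^-1 *: (x *: (vA T - vC T) + y *: (vB T - vC T))
        - (y / x) *: (vB T - vC T).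
      by apply/rowP => i; rewrite !mxE; field.
    by rewrite e scaler0 addr0 scaleNr.
  - by rewrite scale1r addrC subrK.
  - by rewrite scale0r addr0.
split => //; have [//|y0] := eqVneq y 0.
exfalso; apply: nd; exists (vC T), (vA T - vC T), 1, 0, 0; split.
- by rewrite scale1r addrC subrK.
- move: e; rewrite x0 scale0r add0r => /eqP.
  by rewrite scaler_eq0 (negbTE y0) /= subr_eq0 => /eqP ->; rewrite addr0.
- by rewrite scale0r addr0.
Qed.

Lemma bary_inj T : nondegenerate_triangle T -> forall x y x' y' : R,
  bary T x y = bary T x' y' -> x = x' /\ y = y'.
Proof.
move=> nd x y x' y' /eqP; rewrite -subr_eq0 => /eqP e.
have [] := @nondegenerate_free T nd (x - x') (y - y').
  by rewrite -{}[RHS]e /bary !scalerBl; apply/rowP => i; rewrite !mxE; ring.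
by move=> /subr0_eq -> /subr0_eq ->.
Qed.

Lemma bary_weights T (x y z : R) : x + y + z = 1 -> x *: vA T + y *: vB T + z *: vC T = bary T x y.
Proof.
move=> h; rewrite (_ : z = 1 - x - y); last lra.
by rewrite /bary; apply/rowP => i; rewrite !mxE; ring.
Qed.

(** Capping all three weights treats the vertices alike, so one area formula serves the
    parallelograms at every vertex. *)
Definition bary_region T (a b c : R) : set 'rV[R]_d :=
  [set p | exists x y : R, [/\ 0 <= x <= a, 0 <= y <= b, 0 <= 1 - x - y <= c & p = bary T x y]].

Lemma dotv_ge0 u : 0 <= dotv u u.
Proof. by apply: sumr_ge0 => i _; rewrite -expr2 sqr_ge0. Qed.

Lemma dotv_eq0 u : dotv u u = 0 -> u = 0.
Proof.
move=> /eqP; rewrite psumr_eq0 => [/allP h|i _]; last by rewrite -expr2 sqr_ge0.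
apply/rowP => i; have := h i (mem_index_enum i); rewrite /= mulf_eq0 orbb mxE => /eqP.
by move=> ->.
Qed.

Lemma sqrt_dotv_gt0 u : u <> 0 -> 0 < Num.sqrt (dotv u u).
Proof.
move=> u0; rewrite sqrtr_gt0 lt_neqAle dotv_ge0 andbT eq_sym.
by apply/eqP => /dotv_eq0.
Qed.

(** Gram-Schmidt read backwards: A - C = r e1 and B - C = s e1 + h e2, a triangular system solved
    for the weights. *)
Lemma frame_bary T : nondegenerate_triangle T -> exists r h s : R, [/\ 0 < r, 0 < h &
  forall p : R * R, vC T + p.1 *: frame1 T + p.2 *: frame2 T =
     bary T ((p.1 - s * (p.2 / h)) / r) (p.2 / h)].
Proof.
move=> nd; have free := nondegenerate_free nd.
set r := Num.sqrt (dotv (vA T - vC T) (vA T - vC T)).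
have r0 : 0 < r.
  apply: sqrt_dotv_gt0 => u0; have [] := free 1 0; first by rewrite scale1r scale0r addr0.
  by move=> /eqP; rewrite oner_eq0.
set s := dotv (vB T - vC T) (frame1 T).
set w := (vB T - vC T) - s *: frame1 T.
have e1 : frame1 T = r^-1 *: (vA T - vC T) by [].
have h0 : 0 < Num.sqrt (dotv w w).
  apply: sqrt_dotv_gt0 => w0; have [] := free (- (s / r)) 1; last by move=> _ /eqP; rewrite oner_eq0.
  by rewrite -w0 /w e1 scale1r scalerA scaleNr addrC.
exists r, (Num.sqrt (dotv w w)), s; split => // p.
have -> : frame2 T = (Num.sqrt (dotv w w))^-1 *: w by [].
rewrite /w e1 /bary; move: (Num.sqrt _) h0 => h h0.
by apply/rowP => i; rewrite !mxE; field; rewrite !lt0r_neq0.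
Qed.

(** K is the area of the triangle; being the same for all caps, it cancels in the ratio. *)
Lemma vol_bary_region T : nondegenerate_triangle T -> exists2 K : R, 0 < K & forall a b c : R,
  0 <= a -> 0 < b <= 1 -> 0 <= c ->
  vol T (bary_region T a b c) = (K * (slice_prim a c 1 - slice_prim a c (1 - b)))%:E.
Proof.
move=> nd; have [r [h [s [r0 h0 fr]]]] := frame_bary nd.
exists (r * h / 2); first by rewrite divr_gt0 // mulr_gt0.
move=> a b c a0 hb c0; rewrite /vol -(@measure_region _ r h s) //.
congr ((_ \x _)%E _); apply/seteqP; split => p; rewrite /bary_region /region /= fr.
  by move=> [x [y [h1 h2 h3 /(bary_inj nd)[-> ->]]]].
by move=> [h1 h2 h3]; do 2 eexists; split; [exact: h1|exact: h2|exact: h3|].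
Qed.

Lemma tri_set_region T : tri_set T = bary_region T 1 1 1.
Proof.
apply/seteqP; split => p /=.
  move=> [x [y [z [x0 y0 z0 e ->]]]]; exists x, y; split; rewrite ?bary_weights //; lra.
move=> [x [y [hx hy hz ->]]]; exists x, y, (1 - x - y); split; rewrite ?bary_weights //; lra.
Qed.

Lemma nondegenerate_rot T : nondegenerate_triangle T -> nondegenerate_triangle (rot T).
Proof. by move=> nd [w [v [x [y [z [ex ey ez]]]]]]; apply: nd; exists w, v, z, x, y. Qed.

Lemma nondegenerate_swapBC T : nondegenerate_triangle T -> nondegenerate_triangle (swapBC T).
Proof. by move=> nd [w [v [x [y [z [ex ey ez]]]]]]; apply: nd; exists w, v, x, z, y. Qed.

Lemma rot_region T a b c : bary_region (rot T) a b c = bary_region T c a b.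
Proof.
apply/seteqP; split => p [x [y [hx hy hz ->]]].
  exists (1 - x - y), x; split => //; first lra.
  by rewrite /bary /rot /=; apply/rowP => i; rewrite !mxE; ring.
exists y, (1 - x - y); split => //; first lra.
by rewrite /bary /rot /=; apply/rowP => i; rewrite !mxE; ring.
Qed.

Lemma swapBC_region T a b c : bary_region (swapBC T) a b c = bary_region T a c b.
Proof.
apply/seteqP; split => p [x [y [hx hy hz ->]]].
  exists x, (1 - x - y); split => //; first lra.
  by rewrite /bary /swapBC /=; apply/rowP => i; rewrite !mxE; ring.
exists x, (1 - x - y); split => //; first lra.
by rewrite /bary /swapBC /=; apply/rowP => i; rewrite !mxE; ring.
Qed.

Definition corner T a b := parallelogram (vC T) (vA T) (vB T) a b.

Lemma corner_bary T : nondegenerate_triangle T -> forall a b x y : R,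
  corner T a b (bary T x y) <-> (0 <= x <= a /\ 0 <= y <= b).
Proof.
move=> nd a b x y; split.
  by move=> [s [t [hs ht /(bary_inj nd)[-> ->]]]].
by move=> [h1 h2]; exists x, y.
Qed.

Lemma corner_tri T : nondegenerate_triangle T -> forall a b : R, a <= 1 -> b <= 1 ->
  corner T a b `&` tri_set T = bary_region T a b 1.
Proof.
move=> nd a b a1 b1; rewrite tri_set_region; apply/seteqP; split => p.
  move=> [+ [x [y [hx hy hz e]]]]; rewrite e corner_bary // => -[h1 h2].
  by exists x, y.
move=> [x [y [hx hy hz ->]]]; split; first by rewrite corner_bary.
by exists x, y; split => //; lra.
Qed.

End Coordinates.

(** * The discrepancy *)

Section Discrepancy.
Variables (R : realType) (d : nat).
Implicit Types (Omega T : triangle R d).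

(* Twice a * b when a + b <= 1, as 2 is the inverse of the area of the coordinate
   triangle; beyond that, the part outside the triangle is discounted. *)
Definition parallelogram_area (a b : R) :=
  1 - (1 - a) ^+ 2 - (1 - b) ^+ 2 + pos (1 - a - b) ^+ 2.

(** One labelling for each vertex in last place, the other two ordered as in [parallelograms]. *)
Definition relabelling (Omega T : triangle R d) :=
  [\/ T = Omega, T = rot Omega | T = swapBC Omega].

Lemma parallelograms_corner Omega S : parallelograms Omega S <->
  exists T a b, [/\ relabelling Omega T, 0 < a <= 1, 0 < b <= 1 & S = corner T a b].
Proof.
split.
  move=> [[[a [b [ha hb ->]]]|[a [b [ha hb ->]]]]|[a [b [ha hb ->]]]].
  - by exists (rot Omega), a, b; split => //; constructor 2.
  - by exists (swapBC Omega), a, b; split => //; constructor 3.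
  - by exists Omega, a, b; split => //; constructor 1.
move=> [T [a [b [[->|->|->] ha hb ->]]]].
- by right; exists a, b.
- by left; left; exists a, b.
- by left; right; exists a, b.
Qed.

Lemma relabelling_nondegenerate Omega T : nondegenerate_triangle Omega ->
  relabelling Omega T -> nondegenerate_triangle T.
Proof. by move=> nd [->|->|->] //; [apply: nondegenerate_rot|apply: nondegenerate_swapBC]. Qed.

(** Inclusion-exclusion over the corner triangles removed by the caps: requiring weights at least a
    and b leaves a homothetic copy of ratio 1 - a - b, and so on. *)
Lemma slice_prim_area (a b c : R) : 0 <= a -> 0 <= b -> 0 <= c -> a <= 1 -> b <= 1 -> c <= 1 ->
  slice_prim a c 1 - slice_prim a c (1 - b) =
  1 - (1 - a) ^+ 2 - (1 - b) ^+ 2 - (1 - c) ^+ 2 + pos (1 - a - b) ^+ 2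
  + pos (1 - a - c) ^+ 2 + pos (1 - b - c) ^+ 2 - pos (1 - a - b - c) ^+ 2.
Proof.
move=> *; rewrite /slice_prim (@pos_id _ 1) // (@pos_id _ (1 - a)) ?(@pos_id _ (1 - c))
  ?(@pos_id _ (1 - b)); try lra.
by rewrite (addrAC 1 (- b) (- a)); ring.
Qed.

Lemma vol_ratio Omega T (a b : R) : nondegenerate_triangle Omega -> relabelling Omega T ->
  0 < a <= 1 -> 0 < b <= 1 ->
  fine (vol Omega (corner T a b `&` tri_set Omega)) / fine (vol Omega (tri_set Omega)) =
  parallelogram_area a b.
Proof.
move=> nd rl /andP[a0 a1] /andP[b0 b1].
have ndT := relabelling_nondegenerate nd rl.
have [K K0 volK] := vol_bary_region nd.
(* The volume uses the chart of [Omega], so each corner is rewritten in its weights; the apex of the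
   parallelogram gets the cap 1. *)
have [x [y [z [hx hy hz E A]]]] : exists x y z : R, [/\ 0 < x <= 1, 0 < y <= 1, 0 < z <= 1,
    corner T a b `&` tri_set Omega = bary_region Omega x y z &
    slice_prim x z 1 - slice_prim x z (1 - y) = parallelogram_area a b].
  case: rl => e; rewrite e in ndT *.
  - exists a, b, 1; split; rewrite ?a0 ?b0 ?ltr01 ?lexx //; first exact: corner_tri.
    rewrite slice_prim_area; try lra.
    rewrite /parallelogram_area.
    by rewrite (@posN _ (1 - a - 1)) ?(@posN _ (1 - b - 1)) ?(@posN _ (1 - a - b - 1)); [ring|lra..].
  - exists 1, a, b; split; rewrite ?a0 ?b0 ?ltr01 ?lexx //.
      by rewrite -rot_region -corner_tri // !tri_set_region rot_region.
    rewrite slice_prim_area; try lra.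
    rewrite /parallelogram_area.
    by rewrite (@posN _ (1 - 1 - a)) ?(@posN _ (1 - 1 - b)) ?(@posN _ (1 - 1 - a - b)); [ring|lra..].
  - exists a, 1, b; split; rewrite ?a0 ?b0 ?ltr01 ?lexx //.
      by rewrite -swapBC_region -corner_tri // !tri_set_region swapBC_region.
    rewrite slice_prim_area; try lra.
    rewrite /parallelogram_area.
    by rewrite (@posN _ (1 - a - 1)) ?(@posN _ (1 - 1 - b)) ?(@posN _ (1 - a - 1 - b)); [ring|lra..].
rewrite E tri_set_region !volK; try lra.
rewrite /= A slice_prim_area; try lra.
rewrite subrr !(@posN _ (_ - 1)); try lra.
by rewrite !expr0n /= !subr0 !addr0 mulr1 mulrAC divff ?mul1r ?lt0r_neq0.
Qed.

(** By invariance the points of [Omega] may be replaced by those of [T], whose coordinates start at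
    the apex. *)
Lemma local_discrepancy_corner Omega T (a b : R) (k : nat) :
  nondegenerate_triangle Omega -> relabelling Omega T ->
  0 < a <= 1 -> 0 < b <= 1 ->
  local_discrepancy (corner T a b) (mkseq (vdc Omega) (4 ^ k)) Omega =
  parallelogram_area a b
    - (4 ^ k)%:R^-1 * \sum_(0 <= i < 4 ^ k) (\1_(corner T a b) (vdc T i) : R).
Proof.
move=> nd rl ha hb; rewrite /local_discrepancy vol_ratio // size_mkseq; congr (_ - _ * _).
rewrite big_map -[iota _ _]/(iota 0 (4 ^ k)) -{1}[(4 ^ k)%N]subn0 -/(index_iota 0 _).
case: rl => ->; first by [].
  exact/esym/(@sum_vdc_rot _ _ _ (\1_(corner (rot Omega) a b) : _ -> R) Omega k).
exact/esym/(@sum_vdc_swapBC _ _ _ (\1_(corner (swapBC Omega) a b) : _ -> R) Omega k).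
Qed.

Lemma tri_sum_corner (n p q : nat) :
  tri_sum n (fun i j => ((i < p)%N && (j < q)%N)%:R) = lattice_count R n p q.
Proof.
have Q (r s : nat) : tri_sum n (fun i j => ((r <= i) && (s <= j))%N%:R) =
    'C((n - (r + s)).+1, 2)%:R :> R.
  by rewrite -tri_sum_quadrant /tri_sum natr_sum; apply: eq_bigr => i _; rewrite natr_sum.
have := (Q 0 0, Q p 0, Q 0 q)%N; rewrite addn0 addn0 add0n subn0 => -[[Q00 Qp0] Q0q].
rewrite /lattice_count -Q -Q00 -Qp0 -Q0q /tri_sum -!sumrB -big_split /=.
apply: eq_bigr => i _; rewrite -!sumrB -big_split /=.
apply: eq_bigr => j _; rewrite !ltnNge.
by case: (p <= i)%N; case: (q <= j)%N => /=; ring.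
Qed.

Lemma indic_corner T (a b x y : R) : nondegenerate_triangle T -> 0 <= x -> 0 <= y ->
  \1_(corner T a b) (bary T x y) = ((x <= a) && (y <= b))%:R :> R.
Proof.
move=> nd x0 y0; rewrite indicE; congr (_%:R); congr nat_of_bool.
by apply/idP/andP => [|[h1 h2]]; rewrite in_setE corner_bary // x0 y0.
Qed.

Lemma count_corner T (a b : R) (k : nat) (p p' q q' : nat) : let n := (2 ^ k)%N in
  nondegenerate_triangle T ->
  (forall i : nat, (n%:R * a < i%:R + 1/3) = (p <= i)%N) ->
  (forall i : nat, (n%:R * a < i%:R + 2/3) = (p' <= i)%N) ->
  (forall i : nat, (n%:R * b < i%:R + 1/3) = (q <= i)%N) ->
  (forall i : nat, (n%:R * b < i%:R + 2/3) = (q' <= i)%N) ->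
  \sum_(0 <= i < 4 ^ k) (\1_(corner T a b) (vdc T i) : R) =
  lattice_count R n p q + lattice_count R n.-1 p' q'.
Proof.
move=> n nd h1 h2 h3 h4.
have n0 : 0 < n%:R :> R by rewrite ltr0n expn_gt0.
have ge0 (c : R) (i : nat) : 0 <= c -> 0 <= (i%:R + c) / n%:R.
  by move=> c0; rewrite divr_ge0 ?addr_ge0.
rewrite (sum_vdc (\1_(corner T a b) : _ -> R) T k) -!tri_sum_corner; congr (_ + _);
  apply: eq_bigr => i _; apply: eq_bigr => j _; (rewrite indic_corner //; try by apply: ge0; lra);
  by rewrite !ler_pdivrMr // !(mulrC _ n%:R) !leNgt ?h1 ?h2 ?h3 ?h4 -!ltnNge.
Qed.

Lemma local_discrepancy_le Omega T (a b : R) (k : nat) : (0 < k)%N ->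
  nondegenerate_triangle Omega -> relabelling Omega T ->
  0 < a <= 1 -> 0 < b <= 1 ->
  `|local_discrepancy (corner T a b) (mkseq (vdc Omega) (4 ^ k)) Omega| <=
  2 / (3 * (2 ^ k)%:R) - 1 / (9 * (2 ^ k)%:R ^+ 2).
Proof.
move=> k0 nd rl ha hb; set n := (2 ^ k)%N.
have n1 : (1 < n)%N by rewrite (ltn_exp2l 0).
have n0 : 0 < n%:R :> R by rewrite ltr0n expn_gt0.
have rng (x : R) : 0 < x <= 1 -> 0 < n%:R * x <= n%:R.
  by move=> /andP[x0 x1]; rewrite mulr_gt0 //= ler_piMr // ltW.
have [p [p' [gp hp hp']]] := @third_counts_exists _ _ _ (rng a ha).
have [q [q' [gq hq hq']]] := @third_counts_exists _ _ _ (rng b hb).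
rewrite local_discrepancy_corner // (count_corner (relabelling_nondegenerate nd rl) hp hp' hq hq').
have B := lattice_bound n1 (rng a ha) (rng b hb) gp gq.
have -> : (4 ^ k)%:R = n%:R ^+ 2 :> R by rewrite -natrX -expnM mulnC expnM.
rewrite -(ler_pM2l (exprn_gt0 2 n0)).
rewrite (_ : _ * `|_| = `|n%:R ^+ 2 * (parallelogram_area a b
    - (n%:R ^+ 2)^-1 * (lattice_count R n p q + lattice_count R n.-1 p' q'))|); last first.
  by rewrite normrM ger0_norm ?sqr_ge0.
rewrite (_ : _ * (_ - 1 / _) = 2 / 3 * n%:R - 1 / 9); last by field; exact: lt0r_neq0.
apply: le_trans B; rewrite le_eqVlt; apply/orP; left; apply/eqP; congr Num.norm.
rewrite mulrBr mulrA divff ?mul1r ?expf_neq0 ?lt0r_neq0 //; congr (_ - _).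
rewrite /parallelogram_area.
have -> : pos (n%:R - n%:R * a - n%:R * b) = n%:R * pos (1 - a - b).
  by rewrite /pos maxr_pMr ?ltW // mulr0; congr Num.max; ring.
ring.
Qed.

(** Every point has second coordinate at least 1/(3n), so the parallelogram is empty and only its
    area remains. *)
Lemma thin_corner_discrepancy Omega (b : R) (k : nat) : nondegenerate_triangle Omega ->
  0 < b -> b < 1 / (3 * (2 ^ k)%:R) ->
  local_discrepancy (corner Omega 1 b) (mkseq (vdc Omega) (4 ^ k)) Omega = 2 * b - b ^+ 2.
Proof.
move=> nd b0 bn.
have n0 : 0 < (2 ^ k)%:R :> R by rewrite ltr0n expn_gt0.
have n1 : 1 <= (2 ^ k)%:R :> R by rewrite (ler_nat R 1) expn_gt0.
have bn' : b * (2 ^ k)%:R < 1 / 3 by move: bn; rewrite ltr_pdivlMr ?mulr_gt0 //; lra.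
have b1 : b <= 1 by nra.
have rl : relabelling Omega Omega by constructor 1.
rewrite (local_discrepancy_corner k nd rl) ?ltr01 ?lexx ?b0 //.
have ge0 (c : R) (i : nat) : 0 <= c -> 0 <= (i%:R + c) / (2 ^ k)%:R.
  by move=> c0; rewrite divr_ge0 ?addr_ge0.
have far (c : R) (i : nat) : 1/3 <= c -> ((i%:R + c) / (2 ^ k)%:R <= b) = false.
  move=> hc; rewrite ler_pdivrMr //; apply/negbTE; rewrite -ltNge.
  have := ler0n R i; lra.
rewrite (sum_vdc (\1_(corner Omega 1 b) : _ -> R) Omega k) /tri_sum !big1 ?addr0 ?mulr0 ?subr0.
- by rewrite /parallelogram_area subrr posN; [ring|lra].
- move=> i _; rewrite big1 // => j _; rewrite indic_corner ?far ?andbF //; try apply: ge0; lra.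
- move=> i _; rewrite big1 // => j _; rewrite indic_corner ?far ?andbF //; try apply: ge0; lra.
Qed.

Lemma local_discrepancy_single Omega T (a b : R) :
  nondegenerate_triangle Omega -> relabelling Omega T ->
  0 < a <= 1 -> 0 < b <= 1 ->
  local_discrepancy (corner T a b) (mkseq (vdc Omega) (4 ^ 0)) Omega =
  parallelogram_area a b - ((1/3 <= a) && (1/3 <= b))%:R.
Proof.
move=> nd rl ha hb; rewrite local_discrepancy_corner // big_nat1 invr1 mul1r.
rewrite -(@indic_corner T); [|exact: relabelling_nondegenerate rl|lra|lra].
congr (_ - \1__ _); rewrite /vdc /digits4 up_log1 /= /centroid /bary.
by apply/rowP => t; rewrite !mxE; field.
Qed.

(** A parallelogram containing the centroid has relative area at least 2/9, and one missing it has
    area below 1 - (2/3)^2 = 5/9. *)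
Lemma area_single_bound (a b : R) : 0 < a <= 1 -> 0 < b <= 1 ->
  `|parallelogram_area a b - ((1/3 <= a) && (1/3 <= b))%:R| <= 7/9.
Proof.
move=> /andP[a0 a1] /andP[b0 b1]; rewrite ler_norml /parallelogram_area posE.
case: (leP (1/3) a) => ha; case: (leP (1/3) b) => hb /=;
  case: (leP (1 - a - b) 0) => hc; apply/andP; split; rewrite ?mulr1n ?mulr0n; nra.
Qed.
End Discrepancy.

Theorem theorem2 (R : realType) (d : nat) (Omega : triangle R d)
    (hOmega : nondegenerate_triangle Omega) (k N : nat) (hN : N = (4 ^ k)%N) :
  parallelogram_discrepancy (mkseq (vdc Omega) N) Omega =
  (if N == 1%N then 7 / 9
   else 2 / (3 * Num.sqrt (N%:R : R)) - 1 / (9 * N%:R))%:E.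
Proof.
have mem T a b : relabelling Omega T -> 0 < a <= 1 -> 0 < b <= 1 ->
    ((`|local_discrepancy (corner T a b) (mkseq (vdc Omega) N) Omega|)%:E
     <= parallelogram_discrepancy (mkseq (vdc Omega) N) Omega)%E.
  move=> rl ha hb; apply: ereal_sup_ubound; exists (corner T a b) => //.
  by apply/parallelograms_corner; exists T, a, b.
have rl0 : relabelling Omega Omega by constructor 1.
apply/eqP; rewrite eq_le; apply/andP; split.
  apply: ub_ereal_sup => _ [S /parallelograms_corner[T [a [b [rl ha hb ->]]]] <-].
  rewrite lee_fin hN; case: k hN => [|k] hN.
    by rewrite local_discrepancy_single // area_single_bound.
  rewrite ifF; last by rewrite expnS; have := expn_gt0 4 k; lia.
  have -> : (4 ^ k.+1)%:R = (2 ^ k.+1)%:R ^+ 2 :> R by rewrite -natrX -expnM mulnC expnM.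
  rewrite sqrtr_sqr (ger0_norm (ler0n _ _)); exact: local_discrepancy_le.
case: k hN => [|k] hN.
  (* The smallest parallelogram with the centroid on its boundary has area 2/9 and contains the only
     point. *)
  rewrite hN eqxx; move: (mem Omega (1/3) (1/3) rl0); rewrite hN => /(_ ltac:(lra) ltac:(lra)).
  apply: le_trans; rewrite lee_fin local_discrepancy_single //; [|lra|lra].
  rewrite lexx mulr1n (_ : parallelogram_area _ _ - 1 = - (7 / 9)); last first.
    by rewrite /parallelogram_area pos_id; [field|lra].
  by rewrite normrN ger0_norm //; lra.
rewrite ifF; last by rewrite hN expnS; have := expn_gt0 4 k; lia.
have -> : N%:R = (2 ^ k.+1)%:R ^+ 2 :> R by rewrite hN -natrX -expnM mulnC expnM.
rewrite sqrtr_sqr (ger0_norm (ler0n _ _)).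
have n1 : 1 <= (2 ^ k.+1)%:R :> R by rewrite (ler_nat R 1) expn_gt0.
set q : R := 1 / (3 * (2 ^ k.+1)%:R).
have q0 : 0 < q by rewrite divr_gt0 // mulr_gt0 //; lra.
have q1 : q <= 1 by rewrite ler_pdivrMr ?mulr_gt0 //; lra.
rewrite (_ : _ - _ = 2 * q - q ^+ 2); last by rewrite /q; field; apply: lt0r_neq0; lra.
apply/lee_subgt0Pr => eps eps0; rewrite -EFinB.
(* At b = q the parallelogram already reaches points, so b = q - e is used; the loss is 2e - e(2q -
   e) <= eps. *)
have [e [e0 eq e_eps]] : exists e : R, [/\ 0 < e, e < q & 2 * e <= eps].
  by case: (leP q eps) => h; [exists (q / 2)|exists (eps / 2)]; split; lra.
apply: le_trans (mem Omega 1 (q - e) rl0 _ _); [|lra|lra].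
rewrite lee_fin; apply: le_trans (ler_norm _); rewrite hN thin_corner_discrepancy // -?/q; [|lra|lra].
have := mulr_ge0 (ltW e0) (ltac:(lra) : 0 <= 2 * q - e); lra.
Qed.
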